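(* Let $\ell\ge1$ and let $r_{e,\ell}(\mathcal{C}_n)$ be the number of regions of level $\ell$ of the Catalan arrangement $\mathcal{C}_n$ contained in $\{x_1>\dots>x_n\}$. Then \[\sum_{n\ge1} r_{e,\ell}(\mathcal{C}_n)\,t^n=(tC(t))^{\ell},\qquad\text{equivalently}\qquad r_{e,\ell}(\mathcal{C}_n)=\frac{\ell}{2n-\ell}\binom{2n-\ell}{n}\ \ (1\le\ell\le n),\] where $C(t)=\sum_{n\ge0}\frac{1}{n+1}\binom{2n}{n}t^n$ is the generating function of the Catalan numbers.
   Context: The Catalan arrangement $\mathcal{C}_n$ is the arrangement in $\mathbb{R}^n$ of hyperplanes $x_i-x_j=0,1$ for $i\ne j$ (i.e. $x_i-x_j\in\{-1,0,1\}$); for $n=1$ it is empty with unique region $\mathbb{R}$. Regions are connected components of the complement. The level of $X\subseteq\mathbb{R}^n$ is the smallest integer $\ell\ge0$ such that there are a linear subspace $W$ of dimension $\ell$ and $r>0$ with $X\subseteq\{\bm x:\min_{\bm y\in W}\|\bm x-\bm y\|\le r\}$. *)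

(* Defs.v *)
From HB Require Import structures.
From mathcomp Require Import all_boot all_order all_algebra.
From mathcomp Require Import all_classical all_reals all_analysis.
Import Order.TTheory GRing.Theory Num.Theory.
Import numFieldNormedType.Exports.
Local Open Scope classical_set_scope.
Local Open Scope ring_scope.

(* Points of R^n are row vectors 'rV[R]_n, coordinates x_1..x_n are x 0 i,
   i : 'I_n (0-based). 'rV[R]_n carries the product (standard) topology. *)

(* Complement of the Catalan arrangement C_n: x_i - x_j not in {0,1}
   for all i <> j (hence also not -1). *)
Definition catalan_complement (R : realType) (n : nat) : set 'rV[R]_n :=
  [set x | forall i j : 'I_n, i != j ->
             x ord0 i - x ord0 j != 0 /\ x ord0 i - x ord0 j != 1].

Definition catalan_region (R : realType) (n : nat) (X : set 'rV[R]_n) : Prop :=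
  exists2 x, catalan_complement R n x &
             X = connected_component (catalan_complement R n) x.

Definition dominant_cone (R : realType) (n : nat) : set 'rV[R]_n :=
  [set x | forall i j : 'I_n, (i < j)%N -> x ord0 j < x ord0 i].

Definition eucl_dist (R : realType) (n : nat) (x y : 'rV[R]_n) : R :=
  Num.sqrt (\sum_(i < n) (x ord0 i - y ord0 i) ^+ 2).

(* X lies within distance r of the linear subspace W, i.e.
   min_{y in W} ||x - y|| <= r for all x in X (the min is attained since W
   is closed, so this is "exists y in W with ||x-y|| <= r"). *)
Definition near_subspace_of_dim (R : realType) (n : nat) (X : set 'rV[R]_n)
    (l : nat) : Prop :=
  exists (W : {vspace 'rV[R]_n}) (r : R), \dim W = l /\ 0 < r /\
    forall x, X x -> exists2 y, y \in W & eucl_dist R n x y <= r.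

Definition has_level (R : realType) (n : nat) (X : set 'rV[R]_n) (l : nat)
    : Prop :=
  near_subspace_of_dim R n X l /\ forall k, near_subspace_of_dim R n X k -> (l <= k)%N.

Definition dominant_regions_of_level (R : realType) (n l : nat)
    : set (set 'rV[R]_n) :=
  [set X | catalan_region R n X /\ X `<=` dominant_cone R n /\ has_level R n X l].

(* Main.v *)
Require Import Defs.
From HB Require Import structures.
From mathcomp Require Import all_boot all_order all_algebra.
From mathcomp Require Import all_classical all_reals all_analysis.
From mathcomp Require Import zify lra.
Import Order.TTheory GRing.Theory Num.Theory.
Import numFieldNormedType.Exports.

(* A region of the dominant cone is determined by its code s, where s_i is the
   number of j < i with x_j - x_i < 1; the codes are exactly the sequences with
   s_0 = 0 and s_(i+1) <= s_i + 1. Cutting the coordinates before every i with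
   s_i = 0 gives blocks in which consecutive coordinates differ by less than 1,
   while distinct blocks can be moved apart freely. Hence the region stays near
   the span of the indicators of the final segments {i, ..., n-1} with s_i = 0,
   and contains rays in each of these directions, so that its level is the
   number of zeros of s. Codes with a given number of zeros are counted by
   ballot numbers. *)

(** * Enumeration of codes and ballot numbers *)

Definition code_step : rel nat := fun a b => b <= a.+1.

Fixpoint extensions (m a : nat) : seq (seq nat) :=
  if m is m'.+1 then [seq b :: s | b <- iota 0 a.+2, s <- extensions m' b]
  else [:: [::]].

Lemma extensionsS m a : extensions m.+1 a =
  [seq b :: s | b <- iota 0 a.+2, s <- extensions m b].
Proof. by []. Qed.

Lemma mem_extensions m a s :
  (s \in extensions m a) = (size s == m) && path code_step a s.
Proof.
elim: m a s => [|m IH] a s; first by rewrite inE; case: s.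
have memI b : (b \in iota 0 a.+2) = (b <= a.+1) by rewrite mem_iota.
rewrite extensionsS; move: (iota 0 a.+2) memI => I memI.
apply/allpairsPdep/idP => [[b [u [+ + ->]]]|].
  by rewrite memI IH /= eqSS /code_step => -> /andP[-> ->].
case: s => [|b u] //=; rewrite eqSS => /and3P[su ba pu].
by exists b, u; rewrite memI IH su.
Qed.

Lemma uniq_extensions m a : uniq (extensions m a).
Proof.
elim: m a => [|m IH] a //; rewrite extensionsS.
move: (iota 0 a.+2) (iota_uniq 0 a.+2) => I uI.
apply: allpairs_uniq_dep => // -[b u] [c v] _ _ /= [].
by case: _ /; move=> ->.
Qed.

(** [ballot k p] is the coefficient of t^k in C(t)^p; the recursion iterates C^p = C^(p-1) + t
    C^(p+1). *)
Fixpoint ballot (k p : nat) : nat :=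
  if k is k'.+1 then \sum_(i < p) ballot k' i.+2 else 1.

Lemma ballotS k p : ballot k.+1 p.+1 = ballot k.+1 p + ballot k p.+2.
Proof. by rewrite /= big_ord_recr. Qed.

(** Reflection principle, with the subtracted binomial moved to the left. Pascal's rule matches the
    recurrence [ballotS], and at p = 0 the two binomials agree by symmetry. *)
Lemma ballot_bin k p :
  ballot k.+1 p + 'C(2 * k + p.+1, k) = 'C(2 * k + p.+1, k.+1).
Proof.
elim: k p => [|k IHk] p.
  by rewrite /= sum_nat_const card_ord muln1 bin0 bin1 addn1.
elim: p => [|p IHp].
  rewrite [ballot _ _]big_ord0 add0n.
  rewrite -(@bin_sub _ k.+2); last by lia.
  by congr 'C(_, _); lia.
rewrite ballotS; have := IHk p.+2.
have -> : 2 * k.+1 + p.+2 = (2 * k.+1 + p.+1).+1 by lia.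
have -> : 2 * k + p.+3 = 2 * k.+1 + p.+1 by lia.
move: (2 * _ + _) IHp => N; rewrite !binS; lia.
Qed.

Lemma ballot_closed_form k p : (2 * k + p) * ballot k p = p * 'C(2 * k + p, k).
Proof.
case: k => [|k]; first by rewrite bin0.
have := mul_bin_diag (2 * k.+1 + p) k; have := mul_bin_down (2 * k.+1 + p) k.+1.
have -> : (2 * k.+1 + p).-1 = 2 * k + p.+1 by lia.
rewrite -ballot_bin; nia.
Qed.

(* A code that continues from the value [a] and vanishes [l] times is a ballot
   path: it descends from height [a + 1] and then makes [l] excursions from 0,
   whence the generating function [C(t)^(a+1) * (t * C(t))^l]. *)
Lemma count_extensions m a l :
  count (fun s => count_mem 0 s == l) (extensions m a) =
  if l <= m then ballot (m - l) (a + l).+1 else 0.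
Proof.
elim: m a l => [|m IH] a l; first by case: l.
pose F b := count (fun s => (b == 0) + count_mem 0 s == l) (extensions m b).
have -> : count (fun s => count_mem 0 s == l) (extensions m.+1 a) =
    \sum_(b < a.+2) F b.
  rewrite -(big_mkord xpredT F) /index_iota subn0 extensionsS.
  rewrite count_flatten -map_comp sumnE big_map; apply: eq_bigr => b _.
  by rewrite /= count_map.
rewrite big_ord_recl /F /=.
under eq_bigr => b _ do rewrite (eq_count (a2 := fun s => count_mem 0 s == l)) // IH.
case: l {F} => [|l].
  rewrite (eq_count (a2 := pred0)) // count_pred0 add0n addn0 /=.
  by apply: eq_bigr => i _; rewrite addn0 subn0.
rewrite (eq_count (a2 := fun s => count_mem 0 s == l)) // IH add0n ltnS.
case: (ltnP l m) => lm; last first.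
  rewrite big1 // addn0 subSS; case: leqP => // ml.
  by have -> : m - l = 0 by lia.
rewrite ltnW // subSS.
have -> : m - l = (m - l.+1).+1 by lia.
(* Raising [a] by one admits one more first entry, which is exactly one use of [ballotS]. *)
elim: a {IH} => [|a IHa].
  by rewrite big_ord_recl big_ord0 addn0 add0n [in RHS]ballotS.
by rewrite big_ord_recr addnA {}IHa addSn [in RHS]ballotS.
Qed.

Local Open Scope classical_set_scope.
Local Open Scope ring_scope.

(** Past the end [nth] returns 0, so the step condition over all [i] constrains only genuine
    entries. *)
Definition is_code (n : nat) (s : seq nat) : Prop :=
  [/\ size s = n, nth 0%N s 0 = 0%N &
      forall i, (nth 0%N s i.+1 <= (nth 0%N s i).+1)%N].

Definition codes (n : nat) : seq (seq nat) :=
  [seq 0%N :: t | t <- extensions n.-1 0].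

Lemma codesP n s : (0 < n)%N -> reflect (is_code n s) (s \in codes n).
Proof.
case: n => // m _; apply: (iffP mapP) => /= [[t]|[ss s0 sS]].
  rewrite mem_extensions => /andP[/eqP tm /(pathP 0%N) tP] ->.
  split=> //= [|i]; first by rewrite tm.
  have [it|ti] := ltnP i (size t); first exact: tP.
  by rewrite nth_default.
case: s ss s0 sS => [|a t] //= [tm] a0 sS; exists t; last by rewrite a0.
rewrite mem_extensions tm eqxx /=; apply/(pathP 0%N) => i _.
by rewrite a0 in sS; exact: (sS i).
Qed.

Lemma uniq_codes n : uniq (codes n).
Proof. by rewrite map_inj_uniq ?uniq_extensions // => t u []. Qed.

Lemma code_le_index (e : nat -> nat) i :
  e 0%N = 0%N -> (forall i, (e i.+1 <= (e i).+1)%N) -> (e i <= i)%N.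
Proof. by move=> e0 eS; elim: i => [|i IH]; [rewrite e0 | have := eS i; lia]. Qed.

(** * Codes of decreasing sequences *)

Section Realization.
Variable R : realType.

(** Points are placed one by one downwards. A new point must be within 1 of the last [e n.+1] points
    and farther than 1 from the earlier ones; the step condition on [e] makes the interval of
    admissible values nonempty. *)
Lemma decreasing_realization (e : nat -> nat) n :
  e 0%N = 0%N -> (forall i, (e i.+1 <= (e i).+1)%N) ->
  exists y : nat -> R, forall j i, (j < i < n)%N ->
    y i < y j /\ if (i - j <= e i)%N then y j - y i < 1 else 1 < y j - y i.
Proof.
move=> e0 eS; elim: n => [|n [y yP]]; first by exists (fun=> 0) => j i; lia.
case: n => [|n] in yP *; first by exists (fun=> 0) => j i; lia.
have ymono a b : (a <= b < n.+1)%N -> y b <= y a.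
  rewrite leq_eqVlt => /andP[/orP[/eqP->//|ab] bn].
  by have /yP[/ltW] : (a < b < n.+1)%N by rewrite ab.
have en := code_le_index e n.+1 e0 eS.
suff [v [vn vclose vfar]] : exists v, [/\ v < y n,
    forall j, (j <= n)%N -> (n.+1 - j <= e n.+1)%N -> y j - v < 1 &
    forall j, (j <= n)%N -> (e n.+1 < n.+1 - j)%N -> 1 < y j - v].
  exists (fun i => if i == n.+1 then v else y i) => j i /andP[ji iN].
  have jn : (j == n.+1) = false by lia.
  rewrite jn; case: eqP => [->|/eqP in1]; last by apply: yP; lia.
  have yj : y n <= y j by apply: ymono; lia.
  split; first exact: lt_le_trans vn yj.
  by case: leqP => ej; [apply: vclose | apply: vfar]; lia.
have [en0|en_gt0] := posnP (e n.+1).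
  exists (y n - 2); split=> [|j jn|j jn _]; first by lra.
    by rewrite en0; lia.
  by have := ymono j n; rewrite jn ltnSn => /(_ isT); lra.
pose k := (n.+1 - e n.+1)%N.
(* [y k] is the highest point that must be close to the new one; as [e n.+1 <= (e n).+1], it is
   already within 1 of [y n]. *)
have Lyn : y k - 1 < y n.
  have [kn|kn] := ltnP k n; last first.
    by rewrite (_ : k = n); [lra | rewrite /k in kn *; lia].
  have /yP[_] : (k < n < n.+1)%N by rewrite kn ltnSn.
  by rewrite ifT; [lra | have := eS n; rewrite /k; lia].
(* Upper end of the admissible interval: below [y n], and 1 below [y k'], the lowest point that must
   be far. *)
pose U := if k is k'.+1 then Num.min (y n) (y k' - 1) else y n.
have [UL Un] : y k - 1 < U /\ U <= y n.
  rewrite /U; case kE: k => [|k']; first by rewrite -kE.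
  rewrite lt_min ge_min lexx -kE Lyn; split=> //=.
  have /yP[yk _] : (k' < k < n.+1)%N by rewrite /k in kE *; lia.
  by lra.
exists ((y k - 1 + U) / 2); split=> [|j jn je|j jn je]; first by lra.
  have : y j <= y k by apply: ymono; rewrite /k; lia.
  by lra.
suff : U <= y j - 1 by lra.
rewrite /U; case kE: k => [|k']; first by rewrite /k in kE; lia.
by rewrite ge_min lerB ?orbT //; apply: ymono; rewrite /k in kE; lia.
Qed.

Lemma decreasing_code (y : nat -> R) n :
  (forall j i, (j < i < n)%N -> y i < y j) ->
  exists2 s, is_code n s & forall j i, (j < i < n)%N ->
    (i - j <= nth 0%N s i)%N = (y j - y i < 1).
Proof.
move=> ydec.
have kex i : exists j, y j - y i < 1 by exists i; rewrite subrr.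
pose k i := ex_minn (kex i).
have k_min i j : y j - y i < 1 -> (k i <= j)%N.
  by rewrite /k; case: ex_minnP => a _; apply.
have kP i : y (k i) - y i < 1 by rewrite /k; case: ex_minnP.
have ki i : (k i <= i)%N by apply: k_min; rewrite subrr.
have nthE i : (i < n)%N -> nth 0%N (mkseq (fun i => i - k i)%N n) i = (i - k i)%N.
  by move=> ?; rewrite nth_mkseq.
have ymono a b : (a <= b < n)%N -> y b <= y a.
  rewrite leq_eqVlt => /andP[/orP[/eqP->//|ab] bn].
  by apply/ltW/ydec; rewrite ab.
exists (mkseq (fun i => i - k i)%N n).
  split=> [||i]; first by rewrite size_mkseq.
    case: n {ydec ymono} nthE => [|n] nthE; first by [].
    by rewrite nthE.
  have [iN|Ni] := ltnP i.+1 n; last by rewrite nth_default ?size_mkseq.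
  rewrite !nthE; [|lia|lia].
  (* As [y i] exceeds [y i.+1], an index close to [i.+1] is close to [i], so the first close index
     never decreases. *)
  suff : (k i.+1 <= i -> k i <= k i.+1)%N by have := ki i; have := ki i.+1; lia.
  move=> kSi; apply: k_min; have := kP i.+1.
  by have := ydec i i.+1; rewrite ltnSn iN => /(_ isT); lra.
move=> j i /andP[ji iN]; rewrite nthE //.
have -> : (i - j <= i - k i)%N = (k i <= j)%N by have := ki i; lia.
apply/idP/idP => [kj|]; last exact: k_min.
have : y j <= y (k i) by apply: ymono; lia.
by have := kP i; lra.
Qed.

End Realization.

(* The [i]-th entry of the code is the number of [j < i] with [x_j - x_i < 1];
   since [x] is decreasing these are the last ones before [i]. *)
Definition code_region (R : realType) (n : nat) (s : seq nat) : set 'rV[R]_n :=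
  [set x | forall j i : 'I_n, (j < i)%N -> x ord0 i < x ord0 j /\
     if (i - j <= nth 0%N s i)%N then x ord0 j - x ord0 i < 1
     else 1 < x ord0 j - x ord0 i].

(** * Code regions as connected components *)

Section Regions.
Variables (R : realType) (n : nat).
Implicit Types (s : seq nat) (x y : 'rV[R]_n).

Lemma code_region_dominant s : code_region R n s `<=` dominant_cone R n.
Proof. by move=> x xs i j /xs[]. Qed.

Lemma code_region_complement s : code_region R n s `<=` catalan_complement R n.
Proof.
move=> x xs i j; rewrite neq_ltn => /orP[] /xs [xij].
  by case: ifP => _ xc; rewrite -subr_eq0; split; apply/eqP; lra.
by move=> _; split; apply/eqP; lra.
Qed.

Lemma code_region_nonempty s : is_code n s -> exists x, code_region R n s x.
Proof.
case=> _ s0 sS; have [y yP] := @decreasing_realization R (nth 0%N s) n s0 sS.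
exists (\row_i y i) => j i ji; rewrite !mxE; apply: yP.
by rewrite ji ltn_ord.
Qed.

Lemma dominant_code_region x :
  dominant_cone R n x -> catalan_complement R n x ->
  exists2 s, is_code n s & code_region R n s x.
Proof.
move=> xd xc; case: n x xd xc => [|m] x xd xc.
  by exists [::]; [split=> // i; rewrite !nth_nil | case].
have [|s sc sP] := @decreasing_code R (fun i => x ord0 (inord i)) m.+1.
  by move=> j i /andP[ji im]; apply: xd; rewrite !inordK //; lia.
exists s => // j i ji; split; first exact: xd.
have := sP j i; rewrite ji ltn_ord !inord_val => ->//.
have [//|x1] := ltP; rewrite lt_neqAle x1 andbT eq_sym.
by apply: (xc _ _ _).2; rewrite neq_ltn ji.
Qed.

Lemma code_region_inj s s' x : is_code n s -> is_code n s' ->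
  code_region R n s x -> code_region R n s' x -> s = s'.
Proof.
wlog suff le : s s' / is_code n s -> is_code n s' -> code_region R n s x ->
    code_region R n s' x -> forall i, (i < n)%N -> (nth 0 s i <= nth 0 s' i)%N.
  move=> sc sc' xs xs'; have [ss _ _] := sc; have [ss' _ _] := sc'.
  apply: (@eq_from_nth _ 0%N); first by rewrite ss.
  by move=> i; rewrite ss => iN; apply/eqP; rewrite eqn_leq !le.
move=> [_ s0 sS] _ xs xs' i iN; rewrite leqNgt; apply/negP => lt_s's.
have si := code_le_index (nth 0%N s) i s0 sS.
(* The pair (i - a, i) is close according to [s] but far according to [s']. *)
pose a := nth 0%N s i; have jN : (i - a < n)%N by lia.
have ji : (i - a < i)%N by rewrite /a; lia.
have [_] := xs (Ordinal jN) (Ordinal iN) ji.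
have [_] := xs' (Ordinal jN) (Ordinal iN) ji.
by rewrite /= (subKn si) leqnn leqNgt lt_s's /=; lra.
Qed.

Lemma code_region_convex s x y (t : R) : 0 <= t <= 1 ->
  code_region R n s x -> code_region R n s y ->
  code_region R n s (x + t *: (y - x)).
Proof.
move=> /andP[t0 t1] xs ys j i ji; rewrite !mxE.
have conv_gt0 (a b : R) : 0 < a -> 0 < b -> 0 < a + t * (b - a).
  move=> a0 b0; have [->|tn0] := eqVneq t 0; first by lra.
  have tb : 0 < t * b by rewrite mulr_gt0 // lt_neqAle eq_sym tn0.
  by nra.
have [xij xc] := xs j i ji; have [yij yc] := ys j i ji; split.
  by have := conv_gt0 (x 0 j - x 0 i) (y 0 j - y 0 i); lra.
case: ifP xc yc => _ xc yc.
  by have := conv_gt0 (1 - (x 0 j - x 0 i)) (1 - (y 0 j - y 0 i)); lra.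
by have := conv_gt0 (x 0 j - x 0 i - 1) (y 0 j - y 0 i - 1); lra.
Qed.

Lemma connected_code_region s : connected (code_region R n s).
Proof.
have [[x xs]|none] := pselect (exists x, code_region R n s x); last first.
  rewrite (_ : code_region R n s = set0); first exact: connected0.
  by apply/seteqP; split=> // x xs; case: none; exists x.
pose seg y : set 'rV[R]_n := (fun t : R => x + t *: (y - x)) @` `[0, 1].
have -> : code_region R n s = \bigcup_(y in code_region R n s) seg y.
  apply/seteqP; split=> [y ys|z [y ys [t]]].
    exists y => //; exists 1; first by rewrite /= in_itv /= ler01 lexx.
    by rewrite scale1r addrC subrK.
  by rewrite /= in_itv /= => t01 <-; exact: code_region_convex.
apply: bigcup_connected.
  exists x => y _; exists 0; first by rewrite /= in_itv /= ler01 lexx.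
  by rewrite scale0r addr0.
move=> y _; apply: connected_continuous_connected; first exact: segment_connected.
apply: continuous_subspaceT => t; apply: cvgD; first exact: cvg_cst.
exact: scalel_continuous.
Qed.

End Regions.

(** Intermediate value theorem: the image of [C] is an interval that misses 0. *)
Lemma connected_nonvanishing_gt0 (R : realType) (T : topologicalType) (C : set T)
    (f : T -> R) a b :
  connected C -> continuous f -> (forall x, C x -> f x != 0) -> C a -> C b ->
  0 < f a -> 0 < f b.
Proof.
move=> cC cf f0 Ca Cb fa; rewrite ltNge; apply/negP => fb.
have /connected_intervalP : connected (f @` C).
  by apply: connected_continuous_connected => //; apply: continuous_subspaceT.
move=> /(_ (f b) (f a)) /(_ (imageP _ Cb) (imageP _ Ca) 0).
rewrite fb ltW // => /(_ isT)[x Cx fx].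
by have := f0 x Cx; rewrite fx eqxx.
Qed.

Lemma coord_diff_continuous (R : realType) n (j i : 'I_n) :
  continuous (fun x : 'rV[R]_n => x ord0 j - x ord0 i).
Proof.
move=> x; exact: continuousB (@coord_continuous R 1 n ord0 j x)
                             (@coord_continuous R 1 n ord0 i x).
Qed.

(** A code region is connected inside the complement. Conversely, each of its inequalities fixes the
    sign of a continuous function without zeros on the complement, so it persists on the whole
    component. *)
Lemma connected_component_code_region (R : realType) n s (x : 'rV[R]_n) :
  code_region R n s x ->
  connected_component (catalan_complement R n) x = code_region R n s.
Proof.
move=> xs; apply/seteqP; split; last first.
  apply: connected_component_max => //; first exact: code_region_complement.
  exact: connected_code_region.
move=> y Cy j i ji; have [xij xclose] := xs j i ji.
have dc := @coord_diff_continuous R n j i.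
have ji_neq : j != i by rewrite neq_ltn ji.
have Cx : connected_component (catalan_complement R n) x x.
  by apply: connected_component_refl; exact: code_region_complement xs.
have Csub z : connected_component (catalan_complement R n) x z ->
    z ord0 j - z ord0 i != 0 /\ z ord0 j - z ord0 i != 1.
  by move=> /connected_component_sub /(_ j i ji_neq).
have sign (f : 'rV[R]_n -> R) : continuous f ->
    (forall z, connected_component (catalan_complement R n) x z -> f z != 0) ->
    0 < f x -> 0 < f y.
  move=> fc f0; apply: connected_nonvanishing_gt0 fc f0 Cx Cy.
  exact: component_connected.
split.
  rewrite -subr_gt0; apply: (sign (fun z => z ord0 j - z ord0 i)).
  - exact: dc.
  - by move=> z /Csub[].
  - by rewrite subr_gt0.
case: ifP xclose => _ xclose.
  rewrite -subr_gt0; apply: (sign (fun z => 1 - (z ord0 j - z ord0 i))).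
  - by move=> z; apply: (@cvgB R R^o _ _ _ (fun=> 1) _ _ _ _ (dc z)); exact: cvg_cst.
  - by move=> z /Csub[_]; rewrite subr_eq0 eq_sym.
  - by rewrite subr_gt0.
rewrite -subr_gt0; apply: (sign (fun z => z ord0 j - z ord0 i - 1)).
- by move=> z; apply: (@cvgB R R^o _ _ _ _ (fun=> 1) _ _ (dc z)); exact: cvg_cst.
- by move=> z /Csub[_]; rewrite subr_eq0.
- by rewrite subr_gt0.
Qed.

Lemma has_level_unique (R : realType) n (X : set 'rV[R]_n) l l' :
  has_level R n X l -> has_level R n X l' -> l = l'.
Proof.
by move=> [nl lmin] [nl' lmin']; apply/eqP; rewrite eqn_leq lmin ?lmin'.
Qed.

(** * The level of a code region *)

Section Level.
Variables (R : realType) (n : nat).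
Implicit Types (x y v : 'rV[R]_n).

Definition tail_vector (k : 'I_n) : 'rV[R]_n := \row_i (k <= i)%N%:R.

Lemma tail_vectors_free (p : pred 'I_n) :
  free [seq tail_vector k | k <- enum 'I_n & p k].
Proof.
have /perm_free := perm_map tail_vector
  (etrans (perm_filterC p (enum 'I_n) _) (perm_refl _)).
rewrite map_cat => allE.
suff : free [seq tail_vector k | k <- enum 'I_n].
  by rewrite -allE; exact: catl_free.
have -> : map tail_vector (enum 'I_n) = mktuple tail_vector.
  by rewrite /= /image_mem.
apply/freeP => c; under eq_bigr => k _ do rewrite -tnth_nth tnth_mktuple.
move=> cE; suff H m (i : 'I_n) : (i < m)%N -> c i = 0.
  by move=> i; apply: (H i.+1).
(* Triangularity: coordinate [i] involves only vectors with k <= i, so the coefficients vanish one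
   after another. *)
elim: m i => // m IH i im; move/rowP: cE => /(_ i).
rewrite summxE mxE (bigD1 i) //= big1 => [|k ki].
  by rewrite addr0 !mxE leqnn mulr1.
rewrite !mxE; have [ki'|] := leqP k i; last by rewrite mulr0.
have lt_ki : (k < i)%N by rewrite ltn_neqAle ki' andbT.
by rewrite IH ?mul0r //; lia.
Qed.

Lemma eucl_dist_coord_le x y (r : R) i : eucl_dist R n x y <= r ->
  `|x ord0 i - y ord0 i| <= r.
Proof.
apply: le_trans; rewrite /eucl_dist -sqrtr_sqr ler_sqrt ?sumr_ge0 //.
  by rewrite (bigD1 i) //= lerDl sumr_ge0 // => k _; exact: sqr_ge0.
by move=> k _; exact: sqr_ge0.
Qed.

Lemma linear_coord_bound (f : 'End('rV[R]_n)) (i : 'I_n) : exists M : R,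
  forall (u : 'rV[R]_n) (r : R), (forall j, `|u ord0 j| <= r) -> `|f u ord0 i| <= M * r.
Proof.
exists (\sum_j `|f (delta_mx ord0 j) ord0 i|) => u r ur.
rewrite {1}[u]row_sum_delta linear_sum summxE mulr_suml.
apply: le_trans (ler_norm_sum _ _ _) _; apply: ler_sum => j _.
by rewrite linearZ mxE normrM mulrC ler_wpM2l.
Qed.

(* A ray at bounded distance from [W] has its direction in [W]: the projection
   along [W] is a linear map that stays bounded on the ray. *)
Lemma ray_direction_in_subspace (W : {vspace 'rV[R]_n}) x v (r : R) :
  (forall t : R, 0 <= t ->
     exists2 y, y \in W & eucl_dist R n (x - t *: v) y <= r) ->
  v \in W.
Proof.
move=> near; pose f : 'End('rV[R]_n) := (\1 - projv W)%VF.
have fE u : f u = u - projv W u by rewrite !lfunE /= !lfunE.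
suff fv : f v = 0.
  by rewrite (_ : v = projv W v) ?memv_proj //; apply/eqP; rewrite -subr_eq0 -fE fv.
apply/rowP => i; rewrite [RHS]mxE; apply/eqP; apply/negP => /negP fvi.
have [M fM] := linear_coord_bound f i.
set a := f v ord0 i in fvi; set b := f x ord0 i.
have a0 : 0 < `|a| by rewrite normr_gt0.
have bound t : 0 <= t -> `|b - t * a| <= M * r.
  move=> /near[y yW yr].
  have fray : f (x - t *: v - y) = f x - t *: f v.
    have fB u w : f (u - w) = f u - f w by exact: linearB.
    have fy : f y = 0 by rewrite fE projv_id // subrr.
    by rewrite !fB fy subr0 linearZ.
  have -> : b - t * a = f (x - t *: v - y) ord0 i by rewrite fray !mxE.
  by apply: fM => j; have := eucl_dist_coord_le _ _ _ j yr; rewrite !mxE.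
(* Chosen so that t |a| exceeds by 1 the bound M r + |b| from the triangle inequality. *)
pose t := (M * r + `|b| + 1) / `|a|.
have Mr0 : 0 <= M * r by apply: le_trans (bound 0 _).
have t0 : 0 <= t by rewrite divr_ge0 // -addrA addr_ge0 // addr_ge0.
have := bound t t0; have := ler_normB b (b - t * a).
rewrite opprB addrCA subrr addr0 normrM (ger0_norm t0) divfK ?gt_eqF //.
lra.
Qed.

(** The translation widens only the gaps across [k], and these already exceed 1: s_k = 0 and the
    step condition give s_(k+d) <= d. *)
Lemma code_region_ray s (k : 'I_n) x (t : R) :
  is_code n s -> nth 0%N s k = 0%N -> 0 <= t ->
  code_region R n s x -> code_region R n s (x - t *: tail_vector k).
Proof.
move=> [_ _ sS] sk t0 xs j i ji; have [xij xc] := xs j i ji; rewrite !mxE.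
have sle d : (nth 0 s (k + d) <= d)%N.
  by elim: d => [|d IH]; [rewrite addn0 sk | rewrite addnS; have := sS (k + d)%N; lia].
case: (leqP k j) => kj.
  rewrite (leq_trans kj (ltnW ji)) mulr1.
  by split; [lra | case: ifP xc => _ xc; lra].
case: (leqP k i) => ki; last by rewrite mulr0 !subr0.
have /negbTE far : ~~ (i - j <= nth 0 s i)%N.
  by rewrite -ltnNge; have := sle (i - k)%N; rewrite subnKC //; lia.
by move: xc; rewrite far mulr0 mulr1 => xc; split; lra.
Qed.

(** Abel summation: the coefficients are successive differences of coordinates, with 0 read before
    the first. *)
Lemma tail_vector_decomposition x : exists a : 'I_n -> R,
  x = \sum_k a k *: tail_vector k /\
  forall j k : 'I_n, k = j.+1 :> nat -> a k = x ord0 k - x ord0 j.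
Proof.
pose X (i : nat) : R := oapp (x ord0) 0 (insub i).
have XE (i : 'I_n) : X i = x ord0 i by rewrite /X valK.
pose a k := X k - (if k is k'.+1 then X k' else 0).
exists (fun k => a k); split=> [|j k kj]; last by rewrite /a kj -kj !XE.
apply/rowP => i; rewrite summxE.
transitivity (\sum_(k < n | (k < i.+1)%N) a k); last first.
  rewrite big_mkcond; apply: eq_bigr => k _; rewrite !mxE ltnS.
  by case: leqP => _; rewrite ?mulr1 ?mulr0.
rewrite -(big_ord_widen _ a) // -XE.
elim: (nat_of_ord i) => [|p IH].
  by rewrite big_ord_recr big_ord0 /= add0r /a subr0.
by rewrite big_ord_recr /= -IH /a addrC subrK.
Qed.

Lemma dim_span_zero_tails s : size s = n ->
  \dim <<[seq tail_vector k | k : 'I_n <- enum 'I_n & nth 0%N s k == 0%N]>> =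
  count_mem 0%N s.
Proof.
move=> ss; have /eqP -> := tail_vectors_free (fun k : 'I_n => nth 0%N s k == 0%N).
rewrite size_map size_filter -[s in RHS](mkseq_nth 0%N) ss /mkseq.
by rewrite -val_enum_ord [RHS]count_map [RHS]count_map.
Qed.

Lemma code_region_near s : is_code n s ->
  near_subspace_of_dim R n (code_region R n s) (count_mem 0%N s).
Proof.
move=> [ss s0 sS]; pose p (k : 'I_n) := nth 0%N s k == 0%N.
exists <<[seq tail_vector k | k <- enum 'I_n & p k]>>%VS.
exists (Num.sqrt (\sum_(i < n) n%:R ^+ 2) + 1).
split; last split.
- exact: dim_span_zero_tails.
- by rewrite ltr_wpDl // sqrtr_ge0.
move=> x xs; have [a [xE aE]] := tail_vector_decomposition x.
exists (\sum_(k | p k) a k *: tail_vector k).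
  apply: memv_suml => k pk; apply: memvZ; apply: memv_span.
  by apply: map_f; rewrite mem_filter pk mem_enum.
rewrite /eucl_dist; apply: (@le_trans _ _ (Num.sqrt (\sum_(i < n) n%:R ^+ 2))); last first.
  by rewrite lerDl.
rewrite ler_sqrt; last by apply: sumr_ge0 => i _; exact: sqr_ge0.
apply: ler_sum => i _.
rewrite -real_normK ?num_real // ler_sqr ?nnegrE //.
rewrite {1}xE (bigID p) /= mxE addrAC subrr add0r summxE.
apply: le_trans (ler_norm_sum _ _ _) _.
apply: le_trans (_ : _ <= \sum_(k < n) 1) _; last by rewrite sumr_const card_ord.
rewrite big_mkcond; apply: ler_sum => k _; case: ifP => // pk.
rewrite !mxE normrM -[leRHS]mulr1 ler_pM //; last first.
  by case: leqP; rewrite ?normr1 ?normr0.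
have k0 : (0 < k)%N.
  by move: pk; rewrite /p lt0n; apply: contraNneq => ->; rewrite s0.
have jn : (k.-1 < n)%N by have := ltn_ord k; lia.
rewrite (aE (Ordinal jn)) ?prednK //=.
have [|] := xs (Ordinal jn) k; first by rewrite /= prednK.
rewrite /= (_ : (k - k.-1)%N = 1%N) ?lt0n; last by lia.
by rewrite -/(p k) pk => x1 x2; rewrite distrC ger0_norm; lra.
Qed.

(** For minimality, a subspace near the region contains the directions of its rays, hence all tail
    vectors at zeros of [s]. *)
Lemma code_region_has_level s : is_code n s ->
  has_level R n (code_region R n s) (count_mem 0%N s).
Proof.
move=> sc; split; first exact: code_region_near.
have [x xs] := @code_region_nonempty R n s sc.
move=> _ [W [r [<- [_ near]]]]; have [ss _ _] := sc.
rewrite -(dim_span_zero_tails s ss); apply: dimvS; apply/span_subvP => v /mapP[k + ->].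
rewrite mem_filter => /andP[/eqP sk _].
apply: (@ray_direction_in_subspace W x _ r) => t t0.
by apply: near; exact: code_region_ray.
Qed.

End Level.

(** * Counting the regions of given level *)

Lemma dominant_regions_of_levelE (R : realType) n l : (0 < n)%N ->
  dominant_regions_of_level R n l =
  code_region R n @` [set s | (s \in codes n) && (count_mem 0%N s == l)].
Proof.
move=> n0; apply/seteqP; split=> [X [[x xc XE] [Xd Xl]]|_ [s /andP[sc /eqP sl] <-]].
  have xX : X x by rewrite XE; exact: connected_component_refl.
  have [s sc xs] := dominant_code_region _ _ _ (Xd _ xX) xc.
  have XsE : X = code_region R n s by rewrite XE (connected_component_code_region _ _ _ _ xs).
  exists s => //=; apply/andP; split; first exact/codesP.
  apply/eqP; apply: has_level_unique Xl; rewrite XsE.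
  exact: code_region_has_level.
move/(codesP _ _ n0) : sc => sc.
split; last split; [|exact: code_region_dominant|by rewrite -sl; exact: code_region_has_level].
have [x xs] := @code_region_nonempty R n s sc.
exists x; first exact: code_region_complement xs.
by rewrite (connected_component_code_region _ _ _ _ xs).
Qed.

(** The leading 0 is one of the [l] zeros, leaving l - 1 for the extension. *)
Lemma count_codes n l : (0 < n)%N -> (0 < l)%N ->
  count (fun s => count_mem 0%N s == l) (codes n) =
  if (l <= n)%N then ballot (n - l) l else 0%N.
Proof.
case: n l => // n [//|l] _ _; rewrite count_map.
rewrite (eq_count (a2 := fun s => count_mem 0%N s == l)) //.
by rewrite count_extensions subSS.
Qed.

(* r_{e,l}(C_n) = k where the set of such regions is finite of size k;
   the generating function identity sum_n r t^n = (t C(t))^l is equivalent to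
   r = l/(2n-l) * binom(2n-l, n) for 1 <= l <= n and r = 0 for n < l. *)
Theorem theorem5p2 (R : realType) (n l : nat) :
  (1 <= n)%N -> (1 <= l)%N ->
  exists k : nat,
    (dominant_regions_of_level R n l #= `I_k)%card /\
    (if (l <= n)%N
     then (k%:R : rat) = (l%:R / (2 * n - l)%N%:R) * ('C(2 * n - l, n))%:R
     else k = 0%N).
Proof.
move=> n1 l1; exists (count (fun s => count_mem 0%N s == l) (codes n)); split.
  rewrite dominant_regions_of_levelE // -size_filter.
  set L := [seq s <- codes n | count_mem 0%N s == l].
  have uL : uniq L by rewrite filter_uniq ?uniq_codes.
  have LE s : (s \in L) = (s \in codes n) && (count_mem 0%N s == l).
    by rewrite mem_filter andbC.
  have -> : [set s | (s \in codes n) && (count_mem 0%N s == l)] =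
      nth [::] L @` `I_(size L).
    apply/seteqP; split=> [s|_ [i iL <-]]; rewrite /= -LE; last exact: mem_nth.
    by move=> sL; exists (index s L); rewrite /= ?index_mem ?nth_index.
  rewrite image_comp; apply: inj_card_eq => i j; rewrite !inE /= => iL jL ijE.
  have codeL k : (k < size L)%N -> is_code n (nth [::] L k).
    by move=> /(mem_nth [::]); rewrite LE => /andP[/(codesP _ _ n1)].
  apply/eqP; rewrite -(nth_uniq [::] iL jL uL); apply/eqP.
  (* Equal regions share a point, which determines the code. *)
  have [x xs] := @code_region_nonempty R n _ (codeL _ iL).
  by apply: (@code_region_inj R n _ _ x (codeL _ iL) (codeL _ jL)); rewrite -?ijE.
rewrite count_codes //; case: leqP => // ln.
have N0 : ((2 * n - l)%N%:R : rat) != 0 by rewrite pnatr_eq0; lia.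
rewrite mulrAC; apply: (canRL (mulfK N0)); rewrite -!natrM; congr _%:R.
have := ballot_closed_form (n - l) l.
have -> : (2 * (n - l) + l = 2 * n - l)%N by lia.
rewrite mulnC => ->; congr (_ * _)%N.
by rewrite -[RHS]bin_sub; [congr 'C(_, _); lia | lia].
Qed.
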